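(* Let $$P=-\alpha_{1}+\alpha_{2}x+\alpha_{3}y+\alpha_{4}xy,\qquad Q=-\beta_{1}+\beta_{3}x+\beta_{2}y+\beta_{4}xy$$ with real coefficients, and consider the planar system $\dot x=x\,P(x,y)$, $\dot y=y\,Q(x,y)$. Let $(x_{0},y_{0})\in\mathbb{R}^2$ with $x_{0}y_{0}\neq0$ be an equilibrium at which the Jacobian is nilpotent and nonzero, and let $a$ be the first Bogdanov--Takens coefficient there. The following are equivalent: (i) $a=0$; (ii) $P$ and $Q$ have a common nonconstant factor vanishing at $(x_{0},y_{0})$; (iii) $(x_{0},y_{0})$ is not an isolated equilibrium.
   Context: Coefficient $a$: let $X=(xP,yQ)$, $p=(x_0,y_0)$, $J=DX(p)$, $q_0$ spanning $\ker J$, and let $(q_1,p_0,p_1)$ satisfy $Jq_1=q_0$, $J^{\top}p_1=0$, $J^{\top}p_0=p_1$, $\langle q_0,p_0\rangle=\langle q_1,p_1\rangle=1$, $\langle q_0,p_1\rangle=\langle q_1,p_0\rangle=0$. Then $a=\tfrac12\langle p_1,D^2X(p)[q_0,q_0]\rangle$. Rescaling $q_0$ by $c\ne0$ multiplies $a$ by $c$, so its vanishing is well defined. *)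

(* Defs.v *)
From HB Require Import structures.
From mathcomp Require Import all_boot all_order all_algebra.
From mathcomp Require Import all_classical all_reals all_analysis.

Set Implicit Arguments.
Unset Strict Implicit.
Unset Printing Implicit Defensive.

Import Order.TTheory GRing.Theory Num.Theory.
Import numFieldNormedType.Exports.

Local Open Scope ring_scope.

Section Definitions.
Context {R : realType}.

Definition vec2 (x y : R) : 'rV[R]_2 := \row_j (if j == 0 then x else y).

(* Real bivariate polynomials are {poly {poly R}} with the conventions of
   polyXY: the outer variable 'X is x, the inner variable 'Y is y, and
   u.[x, y] is evaluation. *)

Definition kolmogorov_field (P Q : {poly {poly R}}) (z : 'rV[R]_2) : 'rV[R]_2 :=
  let x := z 0 0 in let y := z 0 1 in vec2 (x * P.[x, y]) (y * Q.[x, y]).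

(* The notation %| on {poly {poly R}} is pseudo-division, i.e. divisibility up
   to a nonzero factor in R[y]; a factor in R[x, y] is spelled out instead. *)
Definition common_factor (F P Q : {poly {poly R}}) :=
  (exists G, P = G * F) /\ (exists H, Q = H * F).

Definition nonconstant (F : {poly {poly R}}) := forall c : R, F <> c%:P%:P.

Definition nilpotent_mx n (A : 'M[R]_n) := exists k : nat, A ^+ k = 0.

Definition dot n (u v : 'rV[R]_n) : R := \sum_i u 0 i * v 0 i.

Definition equilibrium n (X : 'rV[R]_n -> 'rV[R]_n) (p : 'rV[R]_n) := X p = 0.

Definition isolated_equilibrium n (X : 'rV[R]_n.+1 -> 'rV[R]_n.+1) p :=
  isolated [set z | equilibrium X z]%classic p.

(* 'J X p acts on row vectors from the right: it is the transpose of the usual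
   Jacobian matrix J, so the column equations J q = r and J^T q = r read
   q *m 'J X p = r and q *m ('J X p)^T = r, and the row space of
   kermx ('J X p) is the kernel of J. *)
Definition bt_chain (X : 'rV[R]_2 -> 'rV[R]_2) (p q0 q1 p0 p1 : 'rV[R]_2) :=
  let A := 'J X p in
  [/\ (q0 == kermx A)%MS,
      q1 *m A = q0,
      p1 *m A^T = 0,
      p0 *m A^T = p1 &
      [/\ dot q0 p0 = 1, dot q1 p1 = 1, dot q0 p1 = 0 & dot q1 p0 = 0]].

Definition bt_coef (X : 'rV[R]_2 -> 'rV[R]_2) (p q0 p1 : 'rV[R]_2) : R :=
  2^-1 * dot p1 ('D_q0 ('D_q0 X) p).

End Definitions.

(* Main.v *)
Require Import Defs.
From mathcomp Require Import all_boot all_order all_algebra.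
From mathcomp Require Import all_classical all_reals all_analysis.
From mathcomp Require Import ring lra.
Import Order.TTheory GRing.Theory Num.Theory.
Import numFieldNormedType.Exports.
Local Open Scope ring_scope.

(* Writing q0 = (h, k) and p1 = (u, v), the chain relations make the Jacobian
   the rank-one matrix q0 p1^T with h u + k v = 0. In the displacement
   (xi, eta) = (x - x0, y - y0) this reads
     x0 P = h (u xi + v eta) + x0 alpha4 xi eta,
     y0 Q = k (u xi + v eta) + y0 beta4 xi eta,
   and a = h k (u x0 alpha4 + v y0 beta4). If a = 0, then xi, eta, or
   u xi + v eta + t xi eta for some t, is a common factor. A nonconstant common
   factor through the equilibrium has degree at most 1 in each variable, so its
   zero set contains an explicit curve through the point. If a <> 0, the
   combination u x0 P + v y0 Q forces xi eta = 0 on common zeros, and hence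
   xi = eta = 0. *)

(** * Directional derivatives of maps that are cubic along a line *)

Section DeriveCubic.
Local Open Scope classical_set_scope.

(** For [s != 0] the difference quotient is exactly [b + s *: (c + s *: d)], which tends to [b]. No
    differentiability of [f] is assumed, so the lemma can be applied again to a directional
    derivative. *)
Lemma derive_cubic {R : realType} (V W : normedModType R) (f : V -> W)
    (a v : V) (b c d : W) :
  (forall s, f (s *: v + a) = f a + s *: (b + s *: (c + s *: d))) ->
  'D_v f a = b.
Proof.
move=> fE; apply/cvg_lim => //.
have cvgb : b + s *: (c + s *: d) @[s --> (0 : R)^'] --> b.
  rewrite -[X in _ --> X]addr0 -[X in _ --> _ + X](scale0r (c + 0 *: d)).
  apply: cvgD; first exact: cvg_cst.
  have cvg0 : s @[s --> (0 : R)^'] --> (0 : R) by exact: cvg_within.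
  apply: cvgZ => //; apply: cvgD; first exact: cvg_cst.
  by apply: cvgZ => //; exact: cvg_cst.
apply: cvg_trans cvgb; apply: near_eq_cvg; near=> s.
rewrite /= fE [f a + _]addrC addrK scalerA mulVf ?scale1r //.
by near: s; exact: nbhs_dnbhs_neq.
Unshelve. all: by end_near. Qed.

End DeriveCubic.

(** * Bilinear polynomials and coordinates in the plane *)

Definition bilinear_poly {R : realType} (a b c d : R) : {poly {poly R}} :=
  a%:P%:P + b%:P%:P * 'X + c%:P%:P * 'Y + d%:P%:P * 'X * 'Y.

Lemma bilinear_polyE {R : realType} (a b c d x y : R) :
  (bilinear_poly a b c d).[x, y] = a + b * x + c * y + d * x * y.
Proof. by rewrite /bilinear_poly !hornerE. Qed.

Lemma vec2E {R : realType} (x y : R) :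
  (vec2 x y 0 0 = x) * (vec2 x y 0 1 = y).
Proof. by rewrite !mxE. Qed.

Lemma vec2_basis {R : realType} (x y : R) :
  vec2 x y = x *: vec2 1 0 + y *: vec2 0 1.
Proof.
apply/rowP => j; rewrite !mxE.
by case: ifP; rewrite !(mulr1, mulr0, addr0, add0r).
Qed.

Lemma vec2_eta {R : realType} (z : 'rV[R]_2) : z = vec2 (z 0 0) (z 0 1).
Proof.
by apply/rowP => j; rewrite mxE; case: j => -[|[|//]] ? /=;
  congr (z _ _); apply/val_inj.
Qed.

Lemma dot2E {R : realType} (u v : 'rV[R]_2) :
  dot u v = u 0 0 * v 0 0 + u 0 1 * v 0 1.
Proof.
rewrite /dot big_ord_recl big_ord1.
by have -> : lift ord0 ord0 = 1 :> 'I_2 by apply/val_inj.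
Qed.

Lemma differentiable_vec2 {R : realType} (V : normedModType R)
    (f g : V -> R) (a : V) :
  differentiable f a -> differentiable g a ->
  differentiable (fun z => vec2 (f z) (g z)) a.
Proof.
move=> df dg.
rewrite (funext (fun z => vec2_basis (f z) (g z))).
by apply: differentiableD; exact: differentiableZl.
Qed.

(** * First and second derivatives of the Kolmogorov field *)

Section KolmogorovField.
Context {R : realType} (a1 a2 a3 a4 b1 b2 b3 b4 : R).

Let X := kolmogorov_field (bilinear_poly a1 a2 a3 a4)
                          (bilinear_poly b1 b2 b3 b4).

Let DX (z v : 'rV[R]_2) : 'rV[R]_2 :=
  let: (x, y, h, k) := (z 0 0, z 0 1, v 0 0, v 0 1) in
  vec2 (h * (a1 + a2 * x + a3 * y + a4 * x * y)
          + x * (a2 * h + a3 * k + a4 * (x * k + y * h)))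
       (k * (b1 + b2 * x + b3 * y + b4 * x * y)
          + y * (b2 * h + b3 * k + b4 * (x * k + y * h))).

Lemma kolmogorov_fieldE (z : 'rV[R]_2) : X z =
  vec2 (z 0 0 * (a1 + a2 * z 0 0 + a3 * z 0 1 + a4 * z 0 0 * z 0 1))
       (z 0 1 * (b1 + b2 * z 0 0 + b3 * z 0 1 + b4 * z 0 0 * z 0 1)).
Proof. by rewrite /X /kolmogorov_field !bilinear_polyE. Qed.

Lemma derive_kolmogorov (z v : 'rV[R]_2) : 'D_v X z = DX z v.
Proof.
pose x := z 0 0; pose y := z 0 1; pose h := v 0 0; pose k := v 0 1.
(* The two vectors are the coefficients of [s ^+ 2] and [s ^+ 3] in the expansion of
   [X (s *: v + z)]. *)
apply: (@derive_cubic _ _ _ _ _ _ _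
  (vec2 (h * (a2 * h + a3 * k + a4 * (x * k + y * h)) + x * (a4 * h * k))
        (k * (b2 * h + b3 * k + b4 * (x * k + y * h)) + y * (b4 * h * k)))
  (vec2 (a4 * h ^+ 2 * k) (b4 * h * k ^+ 2))) => s.
rewrite !kolmogorov_fieldE; apply/rowP => j; rewrite !mxE.
by case: ifP => _; rewrite /x /y /h /k; ring.
Qed.

Lemma derive2_kolmogorov (z v : 'rV[R]_2) :
  let: (x, y, h, k) := (z 0 0, z 0 1, v 0 0, v 0 1) in
  'D_v ('D_v X) z =
  2 *: vec2 (h * (a2 * h + a3 * k + a4 * (x * k + y * h)) + x * (a4 * h * k))
            (k * (b2 * h + b3 * k + b4 * (x * k + y * h)) + y * (b4 * h * k)).
Proof.
have -> : 'D_v X = DX^~ v by apply/funext => w; exact: derive_kolmogorov.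
(* Differentiating the cubic in [s] multiplies its quadratic and cubic coefficients by 2 and 3 and
   leaves a quadratic, hence the last argument 0. *)
apply: (@derive_cubic _ _ _ _ _ _ _ (3 *: vec2 (a4 * v 0 0 ^+ 2 * v 0 1)
  (b4 * v 0 0 * v 0 1 ^+ 2)) 0) => s.
rewrite /DX; apply/rowP => j; rewrite !mxE.
by case: ifP => _; ring.
Qed.

Lemma differentiable_kolmogorov (z : 'rV[R]_2) : differentiable X z.
Proof.
have -> : X = fun z => X z by [].
rewrite (funext kolmogorov_fieldE); apply: differentiable_vec2.
all: have d0 := @differentiable_coord R 1 2 z 0 0.
all: have d1 := @differentiable_coord R 1 2 z 0 1.
all: have dc (c : R) : differentiable (fun _ : 'rV[R]_2 => c) z
  by exact: differentiable_cst.
all: by repeat (apply: differentiableM || apply: differentiableD || done).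
Qed.

Lemma jacobian_kolmogorov (z v : 'rV[R]_2) : v *m 'J X z = DX z v.
Proof.
by rewrite -deriveEjacobian ?derive_kolmogorov //; exact: differentiable_kolmogorov.
Qed.

End KolmogorovField.

(** * The Jacobian as a rank-one matrix *)

Lemma dotE n {R : realType} (u v : 'rV[R]_n) : u *m v^T = (dot u v)%:M.
Proof.
by rewrite [LHS]mx11_scalar mxE; congr (_%:M); apply: eq_bigr => i _; rewrite mxE.
Qed.

(* (q0, q1) and (p0, p1) are dual bases, so p0^T q0 + p1^T q1 = 1. *)
Lemma bt_chain_jacobian {R : realType} (X : 'rV[R]_2 -> 'rV[R]_2)
    (p q0 q1 p0 p1 : 'rV[R]_2) :
  bt_chain X p q0 q1 p0 p1 -> 'J X p = p1^T *m q0.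
Proof.
case=> /andP[/sub_kermxP q0A _] q1A _ _ [d00 d11 d01 d10].
have /mulmx1C : col_mx q0 q1 *m (col_mx p0 p1)^T = 1%:M :> 'M[R]_(1 + 1).
  by rewrite tr_col_mx mul_col_row !dotE d00 d11 d01 d10 raddf0 -scalar_mx_block.
rewrite tr_col_mx mul_row_col => dual.
(* Multiply the decomposition of the identity by the Jacobian: the [q0] term dies and [q1] is sent
   to [q0]. *)
by rewrite -[LHS]mul1mx -dual mulmxDl -!mulmxA q0A q1A mulmx0 add0r.
Qed.

(** * Expansions at a zero, and factors of bilinear polynomials *)

Definition centered_poly {R : realType} (x0 y0 m n t : R) : {poly {poly R}} :=
  m%:P%:P * ('X - x0%:P%:P) + n%:P%:P * ('Y - y0%:P%:P)
  + t%:P%:P * ('X - x0%:P%:P) * ('Y - y0%:P%:P).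

Lemma centered_polyE {R : realType} (x0 y0 m n t x y : R) :
  (centered_poly x0 y0 m n t).[x, y] =
  m * (x - x0) + n * (y - y0) + t * (x - x0) * (y - y0).
Proof. by rewrite /centered_poly !hornerE. Qed.

(** This is the Taylor expansion at a zero: the linear coefficients are the two partial derivatives
    there. *)
Lemma bilinear_poly_centered {R : realType} (x0 y0 a b c d : R) :
  (bilinear_poly a b c d).[x0, y0] = 0 ->
  bilinear_poly a b c d = centered_poly x0 y0 (b + d * y0) (c + d * x0) d.
Proof.
rewrite bilinear_polyE => P0.
have -> : a = - (b * x0 + c * y0 + d * x0 * y0) by lra.
by rewrite /bilinear_poly /centered_poly; ring.
Qed.

Lemma bilinear_poly_sizes {R : realType} (a b c d : R) :
  (size (bilinear_poly a b c d) <= 2)%N /\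
  (size (swapXY (bilinear_poly a b c d)) <= 2)%N.
Proof.
have size_affine (u v : {poly R}) (F : {poly {poly R}}) :
    F = v%:P * 'X + u%:P -> (size F <= 2)%N.
  move=> ->; rewrite size_MXaddC; case: ifP => // _.
  by rewrite ltnS size_polyC; case: (v != 0).
split.
- apply: (size_affine (a%:P + c%:P * 'X) (b%:P + d%:P * 'X)).
  by rewrite /bilinear_poly; ring.
- apply: (size_affine (a%:P + b%:P * 'X) (c%:P + d%:P * 'X)).
  rewrite /bilinear_poly !(rmorphD, rmorphM) /= !swapXY_polyC !map_polyC.
  by rewrite swapXY_X map_polyX; ring.
Qed.

Lemma bilinear_poly_of_sizes {R : realType} (F : {poly {poly R}}) :
  (size F <= 2)%N -> (size (swapXY F) <= 2)%N ->
  F = bilinear_poly F`_0`_0 F`_1`_0 F`_0`_1 F`_1`_1.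
Proof.
move=> sF; rewrite -sizeYE => sYF.
have Fi i : F`_i = (F`_i`_0)%:P + F`_i`_1 *: 'X.
  apply/polyP => j; rewrite !coefE.
  case: j => [|[|j]] /=; rewrite ?mulr0 ?mulr1 ?addr0 ?add0r //.
  by rewrite nth_default //; apply: leq_trans (max_size_coefXY _ _) _;
    exact: leq_trans sYF _.
transitivity (F`_1 *: 'X + (F`_0)%:P); last first.
  by rewrite {1}(Fi 1%N) {1}(Fi 0%N) /bilinear_poly -!mul_polyC; ring.
apply/polyP => i; rewrite !coefE.
case: i => [|[|i]] /=; rewrite ?mulr0 ?mulr1 ?addr0 ?add0r //.
by rewrite nth_default //; apply: leq_trans sF _.
Qed.

(** Degrees in x and in y add up in a product of nonzero polynomials, so a factor again has degree
    at most 1 in each variable. The product must be nonzero, since everything divides 0. *)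
Lemma bilinear_poly_factor {R : realType} (a b c d x0 y0 : R)
    (F G : {poly {poly R}}) :
  bilinear_poly a b c d != 0 -> bilinear_poly a b c d = G * F ->
  F.[x0, y0] = 0 -> exists m n t, F = centered_poly x0 y0 m n t.
Proof.
move=> P0 PE F0; have [sP sYP] := bilinear_poly_sizes a b c d.
have : G * F != 0 by rewrite -PE.
rewrite mulf_eq0 negb_or => /andP[G0 Fneq0].
have size_factor (A B : {poly {poly R}}) : A != 0 -> B != 0 ->
    (size B <= size (A * B)%R)%N.
  move=> A0 B0; rewrite size_mul //.
  by move: A0; rewrite -size_poly_gt0; case: (size A) => // n _; exact: leq_addl.
have sF : (size F <= 2)%N.
  by apply: leq_trans sP; rewrite PE; exact: size_factor.
have sYF : (size (swapXY F) <= 2)%N.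
  by apply: leq_trans sYP; rewrite PE rmorphM; apply: size_factor;
    rewrite swapXY_eq0.
have FE := bilinear_poly_of_sizes F sF sYF.
rewrite FE (bilinear_poly_centered x0 y0); first by do 3 eexists.
by rewrite -FE.
Qed.

(** * Curves of zeros and isolated points *)

Section Curves.
Context {R : realType}.
Local Open Scope classical_set_scope.

Lemma cvg_vec2 (f g : R -> R) (a x y : R) :
  f s @[s --> a] --> x -> g s @[s --> a] --> y ->
  vec2 (f s) (g s) @[s --> a] --> vec2 x y.
Proof.
move=> fx gy; rewrite (funext (fun s => vec2_basis (f s) (g s))) (vec2_basis x y).
by apply: cvgD; apply: cvgZr_tmp.
Qed.

(** Every neighbourhood of [q] contains [g s] for some small nonzero [s], a point of [A] other than
    [q]. *)
Lemma curve_not_isolated (T : topologicalType) (A : set T) (g : R -> T) (q : T) :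
  g s @[s --> (0 : R)] --> q -> (forall s, s != 0 -> g s <> q) ->
  (\forall s \near (0 : R), A (g s)) -> ~ isolated A q.
Proof.
move=> gq gneq gA [_ [V Vq VA]].
have : \forall s \near (0 : R)^', (V `&` A) (g s) /\ s != 0.
  near=> s; split; last by near: s; exact: nbhs_dnbhs_neq.
  by split; near: s; apply: nbhs_dnbhs => //; exact: gq.
move=> /(@filter_ex _ _ (Proper_dnbhs_numFieldType (0 : R))) [s [+ /gneq]].
by rewrite VA.
Unshelve. all: by end_near. Qed.

(** If [m] or [n] is nonzero, the equation can be solved for one displacement as a fraction in the
    other. The denominator is nonzero only near 0, so the curve is a curve of zeros only for small
    [s]. *)
Lemma centered_poly_curve (x0 y0 m n t : R) : exists g : R -> 'rV[R]_2,
  [/\ g s @[s --> (0 : R)] --> vec2 x0 y0,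
      forall s, s != 0 -> g s <> vec2 x0 y0 &
      \forall s \near (0 : R),
        (centered_poly x0 y0 m n t).[g s 0 0, g s 0 1] = 0].
Proof.
have cvg_aff (c d : R) : c + d * s @[s --> (0 : R)] --> c.
  rewrite -[X in _ --> X]addr0 -[X in _ --> _ + X](mulr0 d).
  by apply: cvgD; [exact: cvg_cst | apply: cvgMr; exact: cvg_id].
have near_neq0 (c d : R) : c != 0 -> \forall s \near (0 : R), c + d * s != 0.
  by move=> c0; apply: (cvgr_neq0 _ (cvg_aff c d) c0).
have cvg_frac (z c d e : R) : c != 0 ->
    z - e * s / (c + d * s) @[s --> (0 : R)] --> z.
  move=> c0; rewrite -[X in _ --> X]subr0 -[X in _ --> _ - X](mul0r c^-1).
  apply: cvgB; first exact: cvg_cst.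
  apply: cvgM; last by apply: cvgV => //; exact: cvg_aff.
  have := cvg_aff 0 e; apply: cvg_trans.
  by under [X in _ --> X @ _]eq_fun do rewrite add0r.
have shift_neq (z s : R) : s != 0 -> z + 1 * s <> z.
  by move=> /eqP s0 /eqP; rewrite mul1r -subr_eq0 addrAC subrr add0r => /eqP.
have [m0|m0] := eqVneq m 0; last first.
  exists (fun s => vec2 (x0 - n * s / (m + t * s)) (y0 + 1 * s)); split.
  - by apply: cvg_vec2; [exact: cvg_frac | exact: cvg_aff].
  - by move=> s /(shift_neq y0) + /rowP/(_ 1); rewrite !vec2E.
  - near=> s; rewrite centered_polyE !vec2E.
    have mts : m + t * s != 0 by near: s; exact: near_neq0.
    by field.
have [n0|n0] := eqVneq n 0; last first.
  exists (fun s => vec2 (x0 + 1 * s) (y0 - m * s / (n + t * s))); split.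
  - by apply: cvg_vec2; [exact: cvg_aff | exact: cvg_frac].
  - by move=> s /(shift_neq x0) + /rowP/(_ 0); rewrite !vec2E.
  - near=> s; rewrite centered_polyE !vec2E.
    have nts : n + t * s != 0 by near: s; exact: near_neq0.
    by field.
(* Only the cross term is left, and it vanishes on the horizontal line through the point. *)
exists (fun s => vec2 (x0 + 1 * s) y0); split.
- by apply: cvg_vec2; [exact: cvg_aff | exact: cvg_cst].
- by move=> s /(shift_neq x0) + /rowP/(_ 0); rewrite !vec2E.
- by near=> s; rewrite centered_polyE !vec2E m0 n0; ring.
Unshelve. all: by end_near. Qed.

(** The complement of the axes is a neighbourhood of the point and serves as the isolating one. *)
Lemma isolated_off_axes (X : 'rV[R]_2 -> 'rV[R]_2) (x0 y0 : R) :
  x0 != 0 -> y0 != 0 -> equilibrium X (vec2 x0 y0) ->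
  (forall x y, x != 0 -> y != 0 -> X (vec2 x y) = 0 -> x = x0 /\ y = y0) ->
  isolated_equilibrium X (vec2 x0 y0).
Proof.
move=> x00 y00 Xp uniq; split; first exact/mem_set.
exists [set z : 'rV[R]_2 | z 0 0 != 0 /\ z 0 1 != 0]; last first.
  apply/seteqP; split=> [z [[/= z0 z1]]|z ->]; last by split=> //; rewrite /= !vec2E.
  by rewrite [z]vec2_eta /equilibrium => /uniq[]// -> ->.
have coordN (j : 'I_2) : vec2 x0 y0 0 j != 0 ->
    \forall z \near vec2 x0 y0, (z : 'rV[R]_2) 0 j != 0.
  by move=> ?; apply: (cvgr_neq0 _ (@coord_continuous R 1 2 0 j (vec2 x0 y0))).
by near do split; apply: coordN; rewrite vec2E.
Unshelve. all: by end_near. Qed.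

End Curves.

(** The values at the point and at its two unit translates along the axes are 0, [m] and [n],
    because the cross term vanishes at all three. *)
Lemma centered_poly_nonconstant {R : realType} (x0 y0 m n t : R) :
  (m != 0) || (n != 0) -> nonconstant (centered_poly x0 y0 m n t).
Proof.
move=> mn c Fc.
have Fev x y : m * (x - x0) + n * (y - y0) + t * (x - x0) * (y - y0) = c.
  by rewrite -centered_polyE Fc !hornerE.
have c0 := Fev x0 y0; have cm := Fev (x0 + 1) y0; have cn := Fev x0 (y0 + 1).
by case/orP: mn => /eqP; apply; lra.
Qed.

(** * The cycle of implications from (i) to (ii) to (iii) to (i) *)

Theorem corollary5p5 (R : realType)
    (alpha1 alpha2 alpha3 alpha4 beta1 beta2 beta3 beta4 x0 y0 : R)
    (q0 q1 p0 p1 : 'rV[R]_2) :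
  let P : {poly {poly R}} := - alpha1%:P%:P + alpha2%:P%:P * 'X
             + alpha3%:P%:P * 'Y + alpha4%:P%:P * 'X * 'Y in
  let Q : {poly {poly R}} := - beta1%:P%:P + beta3%:P%:P * 'X
             + beta2%:P%:P * 'Y + beta4%:P%:P * 'X * 'Y in
  let X := kolmogorov_field P Q in
  let p := vec2 x0 y0 in
  x0 * y0 <> 0 ->
  equilibrium X p ->
  nilpotent_mx ('J X p) ->
  'J X p <> 0 ->
  bt_chain X p q0 q1 p0 p1 ->
  [<-> bt_coef X p q0 p1 = 0;
       exists F : {poly {poly R}},
         [/\ common_factor F P Q, nonconstant F & F.[x0, y0] = 0];
       ~ isolated_equilibrium X p].
Proof.
move=> P Q X p /eqP; rewrite mulf_eq0 negb_or => /andP[x00 y00] Xp _ _ chain.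
have PB : P = bilinear_poly (- alpha1) alpha2 alpha3 alpha4.
  by rewrite /bilinear_poly !polyCN.
(* In [Q] the coefficient of x is [beta3] and that of y is [beta2]. *)
have QB : Q = bilinear_poly (- beta1) beta3 beta2 beta4.
  by rewrite /bilinear_poly !polyCN.
have XE : X = kolmogorov_field (bilinear_poly (- alpha1) alpha2 alpha3 alpha4)
                               (bilinear_poly (- beta1) beta3 beta2 beta4).
  by rewrite /X PB QB.
have zeros x y : X (vec2 x y) = vec2 (x * P.[x, y]) (y * Q.[x, y]).
  by rewrite /X /kolmogorov_field !vec2E.
have zerosP x y : x != 0 -> y != 0 -> X (vec2 x y) = 0 ->
    P.[x, y] = 0 /\ Q.[x, y] = 0.
  move=> /negPf x_neq0 /negPf y_neq0; rewrite zeros => /rowP X0.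
  have /eqP := X0 0; have /eqP := X0 1; rewrite !vec2E !mxE !mulf_eq0.
  by rewrite x_neq0 y_neq0 => /eqP -> /eqP ->.
have [P0 Q0] := zerosP _ _ x00 y00 Xp.
pose h := q0 0 0; pose k := q0 0 1; pose u := p1 0 0; pose v := p1 0 1.
have JE (w : 'rV[R]_2) : w *m 'J X p = dot w p1 *: q0.
  by rewrite (bt_chain_jacobian _ _ _ _ _ _ chain) mulmxA dotE mul_scalar_mx.
have [_ _ _ _ [d00 d11 d01 _]] := chain.
have huv : h * u + k * v = 0 by rewrite -dot2E.
have hk0 : (h != 0) || (k != 0).
  rewrite -negb_and; apply/negP => /andP[/eqP h0 /eqP k0].
  by move/eqP: d00; rewrite dot2E -/h -/k h0 k0 !mul0r addr0 eq_sym oner_eq0.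
have uv0 : (u != 0) || (v != 0).
  rewrite -negb_and; apply/negP => /andP[/eqP u0 /eqP v0].
  by move/eqP: d11; rewrite dot2E -/u -/v u0 v0 !mulr0 addr0 eq_sym oner_eq0.
(* By orthogonality of [q0] and [p1], [u = 0] with [k != 0] would make all of [p1] vanish; [vN] is
   the mirror case. *)
have uN : k != 0 -> u != 0.
  move=> k0; apply: contraTneq uv0 => u0; move/eqP: huv.
  by rewrite u0 mulr0 add0r mulf_eq0 (negPf k0) eqxx => /= ->.
have vN : h != 0 -> v != 0.
  move=> h0; apply: contraTneq uv0 => v0; move/eqP: huv.
  by rewrite v0 mulr0 addr0 mulf_eq0 (negPf h0) eqxx orbF => /= ->.
(* Compare the rank-one Jacobian with the explicit one on the two basis vectors. As [P] and [Q]
   vanish at the point, only [x0] or [y0] times their partial derivatives remains. *)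
have [Px Qx Py Qy] : [/\ x0 * (alpha2 + alpha4 * y0) = u * h,
    y0 * (beta3 + beta4 * y0) = u * k, x0 * (alpha3 + alpha4 * x0) = v * h &
    y0 * (beta2 + beta4 * x0) = v * k].
  have J0 := JE (vec2 1 0); have J1 := JE (vec2 0 1).
  move: P0 Q0 J0 J1; rewrite PB QB XE !bilinear_polyE => P0 Q0.
  rewrite !jacobian_kolmogorov !dot2E !vec2E P0 Q0 => /rowP J0 /rowP J1.
  have := J0 0; have := J0 1; have := J1 0; have := J1 1.
  rewrite !mxE -/u -/v -/h -/k /= => ? ? ? ?; split; lra.
have PE : P = centered_poly x0 y0 (u * h / x0) (v * h / x0) alpha4.
  rewrite -Px -Py ![x0 * _]mulrC !mulfK // PB (bilinear_poly_centered x0 y0) //.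
  by rewrite -PB.
have QE : Q = centered_poly x0 y0 (u * k / y0) (v * k / y0) beta4.
  rewrite -Qx -Qy ![y0 * _]mulrC !mulfK // QB (bilinear_poly_centered x0 y0) //.
  by rewrite -QB.
have aE : bt_coef X p q0 p1 = h * k * (u * (x0 * alpha4) + v * (y0 * beta4)).
  (* The derivative of [P] along [q0], times [x0], is [h * (h * u + k * v)], hence 0; likewise for
     [Q]. Only the cross terms of the second derivative survive. *)
  have Pq : alpha2 * h + alpha3 * k + alpha4 * (x0 * k + y0 * h) = 0.
    apply: (mulfI x00); rewrite mulr0.
    transitivity (h * (x0 * (alpha2 + alpha4 * y0))
                  + k * (x0 * (alpha3 + alpha4 * x0))); first by ring.
    by rewrite Px Py -[RHS](mulr0 h) -[in RHS]huv; ring.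
  have Qq : beta3 * h + beta2 * k + beta4 * (x0 * k + y0 * h) = 0.
    apply: (mulfI y00); rewrite mulr0.
    transitivity (h * (y0 * (beta3 + beta4 * y0))
                  + k * (y0 * (beta2 + beta4 * x0))); first by ring.
    by rewrite Qx Qy -[RHS](mulr0 k) -[in RHS]huv; ring.
  rewrite /bt_coef XE derive2_kolmogorov dot2E !mxE /= -/h -/k -/u -/v.
  by rewrite Pq Qq; field.
tfae.
- rewrite aE => a0.
  have [h0|h0] := eqVneq h 0.
    have k0 : k != 0 by rewrite h0 eqxx in hk0.
    (* With [h] and [v] zero, every remaining term of [P] and [Q] contains [x - x0]. *)
    have v0 : v = 0 by apply: (mulfI k0); rewrite mulr0 -huv h0 mul0r add0r.
    exists (centered_poly x0 y0 1 0 0); rewrite PE QE h0 v0; split.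
    + split.
        exists (alpha4%:P%:P * ('Y - y0%:P%:P)).
        by rewrite /centered_poly !(mulr0, mul0r); ring.
      exists ((u * k / y0)%:P%:P + beta4%:P%:P * ('Y - y0%:P%:P)).
      by rewrite /centered_poly !(mulr0, mul0r); ring.
    + by apply: centered_poly_nonconstant; rewrite oner_eq0.
    + by rewrite centered_polyE; ring.
  have [k0|k0] := eqVneq k 0.
    have u0 : u = 0 by apply: (mulfI h0); rewrite mulr0 -huv k0 mul0r addr0.
    exists (centered_poly x0 y0 0 1 0); rewrite PE QE k0 u0; split.
    + split.
        exists ((v * h / x0)%:P%:P + alpha4%:P%:P * ('X - x0%:P%:P)).
        by rewrite /centered_poly !(mulr0, mul0r); ring.
      exists (beta4%:P%:P * ('X - x0%:P%:P)).
      by rewrite /centered_poly !(mulr0, mul0r); ring.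
    + by apply: centered_poly_nonconstant; rewrite oner_eq0 orbT.
    + by rewrite centered_polyE; ring.
  (* This value makes [P] equal to [h / x0] times the factor with coefficients [u], [v], [t]. *)
  pose t := x0 * alpha4 / h.
  have w0 : u * (x0 * alpha4) + v * (y0 * beta4) = 0.
    by apply: (mulfI (mulf_neq0 h0 k0)); rewrite mulr0.
  (* Both [(x0 * alpha4, y0 * beta4)] and [(h, k)] are orthogonal to [(u, v)], hence parallel; so
     the same [t] works for [Q]. *)
  have hyE : h * (y0 * beta4) = k * (x0 * alpha4).
    apply: (mulfI (vN h0)); apply/eqP; rewrite -subr_eq0; apply/eqP.
    transitivity (h * (u * (x0 * alpha4) + v * (y0 * beta4))
                  - (h * u + k * v) * (x0 * alpha4)); first by ring.
    by rewrite w0 huv; ring.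
  have tE : beta4 = k / y0 * t.
    apply: (mulfI (mulf_neq0 h0 y00)); rewrite -mulrA hyE /t; field.
    by rewrite h0 y00.
  exists (centered_poly x0 y0 u v t); split.
  + split.
      exists (h / x0)%:P%:P; rewrite PE /centered_poly.
      have -> : alpha4 = h / x0 * t by rewrite /t; field; rewrite h0 x00.
      ring.
    exists (k / y0)%:P%:P; rewrite QE /centered_poly tE; ring.
  + exact: centered_poly_nonconstant.
  + by rewrite centered_polyE; ring.
- move=> [F [[[G PF] [H QF]] _ F0]].
  have [m [n [t FE]]] : exists m n t, F = centered_poly x0 y0 m n t.
    (* One of [h], [k] is nonzero, so [P] or [Q] has a nonzero linear part and cannot be the
       constant 0. *)
    have P_or_Q : (P != 0) || (Q != 0).
      case/orP: hk0 => [hN|kN]; apply/orP; [left|right]; apply/eqP => PQ0.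
      - apply: (centered_poly_nonconstant x0 y0 (u * h / x0) (v * h / x0)
                  alpha4 _ 0).
          by rewrite !mulf_eq0 !invr_eq0 (negPf x00) (negPf hN) !orbF.
        by rewrite -PE PQ0 !polyC0.
      - apply: (centered_poly_nonconstant x0 y0 (u * k / y0) (v * k / y0)
                  beta4 _ 0).
          by rewrite !mulf_eq0 !invr_eq0 (negPf y00) (negPf kN) !orbF.
        by rewrite -QE PQ0 !polyC0.
    by case/orP: P_or_Q => [PN0|QN0]; [move: PN0 PF | move: QN0 QF];
      rewrite ?PB ?QB => N0 E; exact: bilinear_poly_factor N0 E F0.
  have [g [gp gneq gF]] := centered_poly_curve x0 y0 m n t.
  apply: (curve_not_isolated _ _ g) => //.
  apply: filterS gF => s; rewrite -FE => Fs.
  rewrite /= /equilibrium [g s]vec2_eta zeros PF QF !hornerM Fs !mulr0.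
  by apply/rowP => j; rewrite !mxE if_same.
- move=> not_isolated; apply: contrapT => /eqP; rewrite aE !mulf_eq0 !negb_or.
  move=> /andP[/andP[h0 k0] w0]; apply: not_isolated.
  apply: isolated_off_axes => // x y x_neq0 y_neq0 /(zerosP _ _ x_neq0 y_neq0).
  rewrite PE QE !centered_polyE => -[Pxy Qxy].
  have xPxy : h * (u * (x - x0) + v * (y - y0))
      + x0 * alpha4 * ((x - x0) * (y - y0)) = 0.
    by rewrite -[RHS](mulr0 x0) -Pxy; field.
  have yQxy : k * (u * (x - x0) + v * (y - y0))
      + y0 * beta4 * ((x - x0) * (y - y0)) = 0.
    by rewrite -[RHS](mulr0 y0) -Qxy; field.
  have xy0 : (x - x0) * (y - y0) = 0.
    apply: (mulfI w0); rewrite mulr0.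
    (* Weighting the two equations by [u] and [v] gives the linear part the coefficient
       [h * u + k * v], which is 0. *)
    transitivity (u * (h * (u * (x - x0) + v * (y - y0))
                       + x0 * alpha4 * ((x - x0) * (y - y0)))
                  + v * (k * (u * (x - x0) + v * (y - y0))
                       + y0 * beta4 * ((x - x0) * (y - y0)))
                  - (h * u + k * v) * (u * (x - x0) + v * (y - y0))).
      by ring.
    by rewrite xPxy yQxy huv; ring.
  have L0 : u * (x - x0) + v * (y - y0) = 0.
    by apply: (mulfI h0); rewrite mulr0 -xPxy xy0 mulr0 addr0.
  (* One displacement is zero; the linear relation then kills the other, as [u] and [v] are
     nonzero. *)
  move/eqP: xy0 L0; rewrite mulf_eq0 !subr_eq0 => /orP[/eqP -> | /eqP ->].
  - rewrite subrr mulr0 add0r => /eqP.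
    by rewrite mulf_eq0 (negPf (vN h0)) subr_eq0 => /eqP ->.
  - rewrite subrr mulr0 addr0 => /eqP.
    by rewrite mulf_eq0 (negPf (uN k0)) subr_eq0 => /eqP ->.
Qed.
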